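(* Let $-\infty \le a < b \le \infty$ and let $p, P : (a,b) \to \mathbb{R}$ be continuous functions on the open (finite or infinite) interval $(a,b)$, not necessarily continuous or bounded at its endpoints. Let $u$ be a nontrivial real solution on $(a,b)$ of $$u'' + p(x)\,u = 0$$ which satisfies the boundary conditions $$\int_{a} \frac{dx}{u^2(x)} = \infty, \qquad \int^{b} \frac{dx}{u^2(x)} = \infty .$$ If $P(x) \ge p(x)$ for all $x \in (a,b)$ and $P(x) \not\equiv p(x)$ on $(a,b)$, then every real solution $v$ on $(a,b)$ of $$v'' + P(x)\,v = 0$$ has a zero in $(a,b)$.
   Context: The notation $\int_a \frac{dx}{u^2(x)} = \infty$ means that the integral diverges at the endpoint $a$: for every $c \in (a,b)$, $\int_a^c \frac{dx}{u^2(x)} = \infty$. Similarly $\int^b \frac{dx}{u^2(x)} = \infty$ means that for every $c \in (a,b)$, $\int_c^b \frac{dx}{u^2(x)} = \infty$. The integrals of the nonnegative function $1/u^2$ (with $1/0 = \infty$) take values in $[0,\infty]$. Solutions are real-valued, twice differentiable functions on the open interval $(a,b)$; a zero in $(a,b)$ is a point of the open interval at which the function vanishes. *)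

(* Defs.v *)
From HB Require Import structures.
From mathcomp Require Import all_boot all_order all_algebra.
From mathcomp Require Import all_classical all_reals all_analysis.

Set Implicit Arguments.
Unset Strict Implicit.
Unset Printing Implicit Defensive.

Import Order.TTheory GRing.Theory Num.Theory.
Import numFieldNormedType.Exports.

Local Open Scope classical_set_scope.
Local Open Scope ring_scope.

(* The open interval (a, b) of the real line; the endpoints are extended reals,
   so that it may be unbounded. *)
Definition ooint (R : realType) (a b : \bar R) : set R :=
  [set x : R | (a < x%:E)%E /\ (x%:E < b)%E].

(* Functions on (a, b) are represented by total functions R -> R. Since (a, b)
   is open, derivability and the derivatives at its points depend only on the
   values on (a, b). *)
Definition is_solution (R : realType) (a b : \bar R) (q u : R -> R) : Prop :=
  forall x : R, ooint a b x ->
    [/\ derivable u x 1,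
        derivable u^`()%classic x 1
      & (u^`()^`())%classic x + q x * u x = 0].

(* The inverse is that of \bar R, for which 0^-1 = +oo. *)
Definition inv_sq_integral (R : realType) (u : R -> R) (s t : \bar R) : \bar R :=
  (\int[lebesgue_measure]_(x in ooint s t) ((u x ^+ 2)%:E)^-1)%E.

Definition diverges_at_left (R : realType) (a b : \bar R) (u : R -> R) : Prop :=
  forall c : R, ooint a b c -> inv_sq_integral u a c%:E = +oo%E.

Definition diverges_at_right (R : realType) (a b : \bar R) (u : R -> R) : Prop :=
  forall c : R, ooint a b c -> inv_sq_integral u c%:E b = +oo%E.

(* Main.v *)
Require Import Defs.
From HB Require Import structures.
From mathcomp Require Import all_boot all_order all_algebra.
From mathcomp Require Import all_classical all_reals all_analysis.
From mathcomp Require Import measurable_realfun ring.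

Set Implicit Arguments.
Unset Strict Implicit.
Unset Printing Implicit Defensive.

Import Order.TTheory GRing.Theory Num.Theory.
Import numFieldNormedType.Exports.

Local Open Scope classical_set_scope.
Local Open Scope ring_scope.

(** Suppose that v has no zero, and let W = u' v - u v' be the Wronskian.
    Then (u / v)' = W / v^2 and W' = (P - p) u v, so the function
    G = (u / v) W satisfies Picone's identity
      G' = (P - p) u^2 + (W / v)^2 >= (W / v)^2,
    and G^2 = u^2 (W / v)^2. Hence G is nondecreasing and, wherever it does not
    vanish, u does not vanish either and 1 / u^2 <= G' / G^2 = (- 1 / G)'.

    If G c > 0 for some c, then G >= G c > 0 on (c, b), where - 1 / G is
    therefore bounded, and integrating the last inequality bounds the integral
    of 1 / u^2 on (c, b) by 1 / G c: this contradicts divergence at b.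
    If G c < 0, the same argument on (a, c) contradicts divergence at a. The two
    cases share [ooint_inv_sq_integral_fin]; together they give [picone_eq0],
    that is, G = 0 on (a, b).

    Both nonnegative terms of G' then vanish. From W = 0 it follows that u / v
    is constant; from (P - p) u^2 = 0, that u is zero at a point where P and p
    differ. So the constant is 0 and u = 0, contrary to its nontriviality. *)

(** * Calculus on an open interval with extended real endpoints *)

Lemma open_ooint (R : realType) (s t : \bar R) : open (ooint s t).
Proof. by apply: openI; [exact: open_ereal_gt|exact: open_ereal_lt]. Qed.

Lemma ooint_convex (R : realType) (s t : \bar R) (x y z : R) :
  ooint s t x -> ooint s t y -> x <= z -> z <= y -> ooint s t z.
Proof.
move=> [sx _] [_ yt] xz zy; split.
  by apply: (lt_le_trans sx); rewrite lee_fin.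
by apply: le_lt_trans yt; rewrite lee_fin.
Qed.

Lemma is_derive_continuous (R : realType) (f : R -> R) (x df : R) :
  is_derive x 1 f df -> {for x, continuous f}.
Proof.
by move=> [df' _]; apply/differentiable_continuous/derivable1_diffP.
Qed.

Lemma ooint_MVT (R : realType) (s t : \bar R) (f g : R -> R) (x y : R) :
  (forall z, ooint s t z -> is_derive z 1 f (g z)) ->
  ooint s t x -> ooint s t y -> x <= y ->
  exists2 z, ooint s t z & f y - f x = g z * (y - x).
Proof.
move=> fg xI yI xy.
have sub z : z \in `[x, y] -> ooint s t z.
  by rewrite in_itv => /andP[]; exact: ooint_convex.
have dfg z : z \in `]x, y[ -> is_derive z 1 f (g z).
  by move=> /subset_itv_oo_cc zxy; exact/fg/sub.
have cf : {within `[x, y], continuous f}.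
  by apply: derivable_within_continuous => z /sub /fg[].
by have [z /sub zI ->] := MVT_segment xy dfg cf; exists z.
Qed.

Lemma ooint_nondecreasing (R : realType) (s t : \bar R) (f g : R -> R)
    (x y : R) :
  (forall z, ooint s t z -> is_derive z 1 f (g z)) ->
  (forall z, ooint s t z -> 0 <= g z) ->
  ooint s t x -> ooint s t y -> x <= y -> f x <= f y.
Proof.
move=> fg g0 xI yI xy.
have [z zI fE] := ooint_MVT fg xI yI xy.
by rewrite -subr_ge0 fE mulr_ge0 ?subr_ge0// g0.
Qed.

(** * Integrals bounded by the oscillation of a primitive *)

(** Strictness of [m < e n] keeps the compact intervals built below
    nondegenerate. *)
Lemma ereal_lt_exhaustion (R : realType) (t : \bar R) (m : R) : (m%:E < t)%E ->
  exists e : nat -> R, [/\ {homo e : i j / (i <= j)%N >-> i <= j},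
    forall n, m < e n /\ ((e n)%:E < t)%E
    & forall x, (x%:E < t)%E -> exists n, x <= e n].
Proof.
case: t => [t | _ | //].
(* n + 2 rather than n + 1, so that the first term already exceeds m. *)
- rewrite lte_fin -subr_gt0 => tm0; exists (fun n => t - (t - m) / n.+2%:R).
  split => [i j ij | n | x].
  + by rewrite lerD2l lerN2 ler_pM2l// lef_pV2 ?posrE ?ltr0Sn// ler_nat.
  + rewrite lte_fin; split; last by rewrite ltrBlDr ltrDl divr_gt0 ?ltr0Sn.
    by rewrite ltrBrDr -ltrBrDl ltr_pdivrMr ?ltr0Sn// ltr_pMr// ltr1n.
  + rewrite lte_fin -subr_gt0 => tx0; exists (Num.bound ((t - m) / (t - x))).
    rewrite lerBrDr -lerBrDl ler_pdivrMr ?ltr0Sn// -ler_pdivrMl// mulrC.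
    apply: (le_trans (ltW (archi_boundP (divr_ge0 (ltW tm0) (ltW tx0))))).
    by rewrite ler_nat 2?leqW.
- exists (fun n => m + n.+1%:R); split => [i j ij | n | x _].
  + by rewrite lerD2l ler_nat.
  + by rewrite ltrDl ltr0Sn ltry.
  + exists (Num.bound `|x - m|).
    rewrite -lerBlDl; apply: le_trans (ler_norm _) _.
    apply: (le_trans (ltW (archi_boundP (normr_ge0 _)))).
    by rewrite ler_nat leqW.
Qed.

(** Left endpoints are obtained by exhausting the reflected half-line
    from - m up to - s. *)
Lemma ooint_exhaustion (R : realType) (s t : \bar R) (m : R) : ooint s t m ->
  exists l r : nat -> R, [/\ forall n, l n < r n,
    forall n, ooint s t (l n) /\ ooint s t (r n),
    {homo (fun n => `[l n, r n]%classic) : i j / (i <= j)%N >-> (i <= j)%O}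
    & \bigcup_n `[l n, r n]%classic = ooint s t].
Proof.
move=> [sm mt].
have [r [rmono rI rU]] := ereal_lt_exhaustion mt.
have : ((- m)%:E < - s)%E by rewrite EFinN lteN2.
move=> /ereal_lt_exhaustion[l [lmono lI lU]].
have lrI n : ooint s t (- l n) /\ ooint s t (r n).
  have [ml ls] := lI n; have [mr rt] := rI n.
  have sl : (s < (- l n)%:E)%E by rewrite EFinN lteNr.
  split; split => //.
    by apply: lt_trans mt; rewrite lte_fin ltrNl.
  by apply: (lt_trans sm); rewrite lte_fin.
exists (fun n => - l n), r; split => //.
- move=> n; have [ml _] := lI n; have [mr _] := rI n.
  by apply: lt_trans mr; rewrite ltrNl.
- move=> i j ij; rewrite subsetEset => x /=; rewrite !in_itv/= => /andP[lx xr].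
  rewrite (le_trans _ lx) ?lerN2 ?lmono//=.
  exact: le_trans xr (rmono _ _ ij).
- apply/seteqP; split => [x [n _] /=|x [sx xt]].
    by rewrite in_itv/= => /andP[]; apply: ooint_convex; apply lrI.
  have /lU[i xi] : ((- x)%:E < - s)%E by rewrite EFinN lteN2.
  have [j xj] := rU _ xt.
  exists (maxn i j) => //=; rewrite in_itv/= lerNl.
  rewrite (le_trans xi) ?lmono ?leq_maxl//=.
  by rewrite (le_trans xj)// rmono// leq_maxr.
Qed.

(** On a compact [l, r] inside the interval, the integral of f is at most that
    of g, which is F r - F l <= M by the fundamental theorem of calculus;
    monotone convergence along an exhaustion passes this bound to the whole
    interval, whether or not F has limits at the endpoints. *)
Lemma ooint_integral_le (R : realType) (s t : \bar R) (f g F : R -> R) (M : R) :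
  (forall x, ooint s t x -> {for x, continuous f}) ->
  (forall x, ooint s t x -> {for x, continuous g}) ->
  (forall x, ooint s t x -> is_derive x 1 F (g x)) ->
  (forall x, ooint s t x -> 0 <= f x <= g x) ->
  (forall x y, ooint s t x -> ooint s t y -> x <= y -> F y - F x <= M) ->
  0 <= M ->
  (\int[lebesgue_measure]_(x in ooint s t) (f x)%:E <= M%:E)%E.
Proof.
move=> fc gc Fg fg FM M0.
have [->|/set0P[m mI]] := eqVneq (ooint s t) set0.
  by rewrite integral_set0 lee_fin.
have [l [r [lr lrI lrmono lrU]]] := ooint_exhaustion mI.
have sub n z : `[l n, r n]%classic z -> ooint s t z.
  by move=> ?; rewrite -lrU; exists n.
have mI' n : measurable `[l n, r n] by exact: measurable_itv.
have mf (h : R -> R) n : (forall x, ooint s t x -> {for x, continuous h}) ->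
    measurable_fun `[l n, r n]%classic (fun x : R => (h x)%:E).
  move=> hc; apply/measurable_EFinP.
  apply: (@measurable_funS _ _ _ _ (ooint s t)) => //.
  - by apply: open_measurable; exact: open_ooint.
  - by move=> z; exact: sub.
  - apply: open_continuous_measurable_fun; first exact: open_ooint.
    by move=> z; rewrite inE; exact: hc.
have f0 n z : `[l n, r n]%classic z -> (0 <= (f z)%:E)%E.
  by move=> /sub/fg/andP[]; rewrite lee_fin.
rewrite -lrU.
have cvgf := @ge0_nondecreasing_set_cvg_integral _ (measurableTypeR R) R _
  (fun x => (f x)%:E)
  lebesgue_measure lrmono mI' (fun n => mf f n fc) f0.
apply: (cvge_to_le cvgf); apply: nearW => n.
have [lI rI] := lrI n.
apply: (@le_trans _ _ (\int[lebesgue_measure]_(x in `[l n, r n]) (g x)%:E)%E).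
  apply: ge0_le_integral => //; [exact: f0|exact: mf|exact: mf|].
  by move=> z /sub/fg/andP[]; rewrite lee_fin.
have gw : {within `[l n, r n], continuous g}.
  by apply: continuous_in_subspaceT => z; rewrite inE => /sub; exact: gc.
have Fd : derivable_oo_LRcontinuous F (l n) (r n).
  split.
  - by move=> z /subset_itv_oo_cc/sub/Fg[].
  - by apply: cvg_at_right_filter; exact: is_derive_continuous (Fg _ lI).
  - by apply: cvg_at_left_filter; exact: is_derive_continuous (Fg _ rI).
have FE : {in `]l n, r n[%R, F^`()%classic =1 g}.
  by move=> z /subset_itv_oo_cc/sub/Fg ?; rewrite derive1E; exact: derive_val.
rewrite (continuous_FTC2 (lr n) gw Fd FE) -EFinB lee_fin.
by apply: FM => //; exact: ltW.
Qed.

(** The Riccati inequality G^2 <= u^2 G' says that 1 / u^2 <= (- 1 / G)', so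
    the integral of 1 / u^2 is bounded by the oscillation K of - 1 / G. It also
    forces u to be nonzero wherever G is. *)
Lemma ooint_inv_sq_integral_fin (R : realType) (s t : \bar R) (u G G' : R -> R)
    (K : R) :
  (forall x, ooint s t x -> {for x, continuous u}) ->
  (forall x, ooint s t x -> {for x, continuous G'}) ->
  (forall x, ooint s t x -> is_derive x 1 G (G' x)) ->
  (forall x, ooint s t x -> G x ^+ 2 <= u x ^+ 2 * G' x) ->
  (forall x y, ooint s t x -> ooint s t y -> x <= y ->
    (G x)^-1 - (G y)^-1 <= K) ->
  (forall x, ooint s t x -> G x != 0) ->
  0 <= K -> inv_sq_integral u s t != +oo%E.
Proof.
move=> uc G'c GG' GuG' GK G0 K0.
have u0 x : ooint s t x -> u x != 0.
  move=> xI; apply: contra_neq (G0 _ xI) => ux; move: (GuG' _ xI).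
  rewrite ux expr0n/= mul0r => G2; apply/eqP.
  by rewrite -sqrf_eq0 eq_le G2 sqr_ge0.
rewrite -ltey (le_lt_trans _ (ltry K))// /inv_sq_integral.
have -> : (\int[lebesgue_measure]_(x in ooint s t) ((u x ^+ 2)%:E)^-1 =
    \int[lebesgue_measure]_(x in ooint s t) ((u x ^+ 2)^-1)%:E)%E.
  apply: eq_integral => x; rewrite inE => /u0 ux.
  by rewrite inver expf_eq0/= (negbTE ux).
have Gc x : ooint s t x -> {for x, continuous G}.
  by move=> xI; exact: is_derive_continuous (GG' _ xI).
apply: (@ooint_integral_le _ _ _ _ (fun x => G' x * (G x ^+ 2)^-1)
  (fun x => - (G x)^-1)) => //.
- move=> x xI; apply: continuousV; first by rewrite expf_neq0 ?u0.
  by apply: (@continuousM _ _ u u); exact: uc.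
- move=> x xI; apply: continuousM; first exact: G'c.
  apply: continuousV; first by rewrite expf_neq0 ?G0.
  by apply: (@continuousM _ _ G G); exact: Gc.
- move=> x xI; have dG := GG' _ xI.
  have dV := is_deriveN (is_deriveV (G0 _ xI) dG).
  apply: is_derive_eq dV _.
  by rewrite /GRing.scale/= mulNr opprK mulrC.
- move=> x xI.
  have G2 : 0 < G x ^+ 2 by rewrite exprn_even_gt0//= G0.
  have u2 : 0 < u x ^+ 2 by rewrite exprn_even_gt0//= u0.
  rewrite invr_ge0 ltW//= ler_pdivlMr// ler_pdivrMl//.
  exact: GuG'.
- by move=> x y xI yI xy; rewrite opprK addrC; exact: GK.
Qed.

(** * The Wronskian and Picone's identity *)

Definition wronskian (R : realType) (u v : R -> R) : R -> R :=
  u^`()%classic * v - u * v^`()%classic.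

(** Equal to u u' - u^2 v' / v. The product form makes the
    derivative visible: that of u / v is W / v^2 and that of W is
    (P - p) u v. *)
Definition picone (R : realType) (u v : R -> R) : R -> R :=
  (fun x => u x / v x) * wronskian u v.

Lemma solution_is_derive (R : realType) (a b : \bar R) (q w : R -> R) (x : R) :
  is_solution a b q w -> ooint a b x ->
  is_derive x 1 w (w^`()%classic x) /\
  is_derive x 1 w^`()%classic (- (q x * w x)).
Proof.
move=> w_sol xI; have [dw ddw wE] := w_sol _ xI; split.
  by rewrite derive1E; exact: derivableP.
apply: is_derive_eq (derivableP ddw) _.
by rewrite -derive1E; apply/eqP; rewrite -addr_eq0 wE.
Qed.

Lemma is_derive_wronskian (R : realType) (a b : \bar R) (p P u v : R -> R)
    (x : R) :
  is_solution a b p u -> is_solution a b P v -> ooint a b x ->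
  is_derive x 1 (wronskian u v) ((P x - p x) * (u x * v x)).
Proof.
move=> u_sol v_sol xI.
have [du ddu] := solution_is_derive u_sol xI.
have [dv ddv] := solution_is_derive v_sol xI.
apply: (is_derive_eq (is_deriveB (is_deriveM ddu dv) (is_deriveM du ddv))).
by rewrite /GRing.scale/=; ring.
Qed.

Lemma is_derive_quotient (R : realType) (a b : \bar R) (p P u v : R -> R)
    (x : R) :
  is_solution a b p u -> is_solution a b P v -> v x != 0 -> ooint a b x ->
  is_derive x 1 (fun y => u y / v y) (wronskian u v x / v x ^+ 2).
Proof.
move=> u_sol v_sol vx xI.
have [du _] := solution_is_derive u_sol xI.
have [dv _] := solution_is_derive v_sol xI.
apply: (is_derive_eq (is_deriveM du (is_deriveV vx dv))).
by rewrite /wronskian !fctE /GRing.scale/=; field.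
Qed.

(** Picone's identity: W is proportional to the derivative of u / v, whence the
    square. *)
Lemma is_derive_picone (R : realType) (a b : \bar R) (p P u v : R -> R)
    (x : R) :
  is_solution a b p u -> is_solution a b P v -> v x != 0 -> ooint a b x ->
  is_derive x 1 (picone u v)
    ((P x - p x) * u x ^+ 2 + (wronskian u v x / v x) ^+ 2).
Proof.
move=> u_sol v_sol vx xI.
apply: (is_derive_eq (is_deriveM (is_derive_quotient u_sol v_sol vx xI)
  (is_derive_wronskian u_sol v_sol xI))).
by rewrite /GRing.scale/=; field.
Qed.

(** * Vanishing of the Picone function and the comparison theorem *)

(** The Picone function G is nondecreasing, so a nonzero value G c persists with
    its sign on one side of c: up to b if positive, down to a if negative. There
    1 / G varies by at most 1 / |G c|, and 1 / u^2 is integrable. *)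
Lemma picone_eq0 (R : realType) (a b : \bar R) (p P u v : R -> R) :
  {within ooint a b, continuous p} -> {within ooint a b, continuous P} ->
  is_solution a b p u -> is_solution a b P v ->
  diverges_at_left a b u -> diverges_at_right a b u ->
  (forall x, ooint a b x -> p x <= P x) ->
  (forall x, ooint a b x -> v x != 0) ->
  forall c, ooint a b c -> picone u v c = 0.
Proof.
rewrite (continuous_open_subspace p (@open_ooint R a b)).
rewrite (continuous_open_subspace P (@open_ooint R a b)).
move=> pc Pc u_sol v_sol u_left u_right pP v0 c cI.
pose G' x := (P x - p x) * u x ^+ 2 + (wronskian u v x / v x) ^+ 2.
have dG x : ooint a b x -> is_derive x 1 (picone u v) (G' x).
  by move=> xI; exact: is_derive_picone u_sol v_sol (v0 _ xI) xI.
have G'0 x : ooint a b x -> 0 <= G' x.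
  by move=> xI; rewrite addr_ge0 ?sqr_ge0// mulr_ge0 ?sqr_ge0 ?subr_ge0 ?pP.
have Gmono := ooint_nondecreasing dG G'0.
have uc x : ooint a b x -> {for x, continuous u}.
  by move=> xI; have [/is_derive_continuous] := solution_is_derive u_sol xI.
have vc x : ooint a b x -> {for x, continuous v}.
  by move=> xI; have [/is_derive_continuous] := solution_is_derive v_sol xI.
have wc x : ooint a b x -> {for x, continuous (wronskian u v)}.
  move=> xI.
  exact: is_derive_continuous (is_derive_wronskian u_sol v_sol xI).
have G'c x : ooint a b x -> {for x, continuous G'}.
  move=> xI; have xI' : x \in ooint a b by rewrite inE.
  have qc : {for x, continuous (fun y => wronskian u v y / v y)}.
    apply: continuousM; first exact: wc.
    by apply: continuousV; [exact: v0 | exact: vc].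
  apply: continuousD; last exact: (continuousM qc qc).
  apply: continuousM; last by apply: (@continuousM _ _ u u); exact: uc.
  by apply: continuousB; [exact: Pc | exact: pc].
have GuG' x : ooint a b x -> picone u v x ^+ 2 <= u x ^+ 2 * G' x.
  move=> xI.
  have -> : picone u v x ^+ 2 = u x ^+ 2 * (wronskian u v x / v x) ^+ 2.
    by rewrite /picone fctE; ring.
  by rewrite ler_wpM2l ?sqr_ge0// lerDr mulr_ge0 ?sqr_ge0// subr_ge0 pP.
have [Gc0|Gc0|//] := ltgtP (picone u v c) 0.
- have sub x : ooint a c%:E x -> ooint a b x.
    by move=> [ax xc]; split => //; apply: (lt_trans xc); case: cI.
  have Gle x : ooint a c%:E x -> picone u v x <= picone u v c.
    by move=> xI; apply: Gmono; [exact: sub| |rewrite -lee_fin ltW//; case: xI].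
  have Gneg x xI := le_lt_trans (Gle x xI) Gc0.
  have Gneq x : ooint a c%:E x -> picone u v x != 0.
    by move=> /Gneg /lt_eqF ->.
  have : inv_sq_integral u a c%:E != +oo%E.
    apply: (@ooint_inv_sq_integral_fin _ _ _ _ (picone u v) G'
      (- (picone u v c)^-1)) => //.
    + by move=> x /sub; exact: uc.
    + by move=> x /sub; exact: G'c.
    + by move=> x /sub; exact: dG.
    + by move=> x /sub; exact: GuG'.
    + move=> x y xI yI xy; rewrite -[leRHS]add0r lerD//.
        by rewrite invr_le0 ltW// Gneg.
      by rewrite lerN2 lef_nV2 ?negrE ?(Gneg _ yI)// Gle.
    + by rewrite oppr_ge0 invr_le0 ltW.
  by rewrite u_left// eqxx.
- have sub x : ooint c%:E b x -> ooint a b x.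
    by move=> [cx xb]; split => //; apply: lt_trans cx; case: cI.
  have Gge x : ooint c%:E b x -> picone u v c <= picone u v x.
    by move=> xI; apply: Gmono; [|exact: sub|rewrite -lee_fin ltW//; case: xI].
  have Gpos x xI := lt_le_trans Gc0 (Gge x xI).
  have Gneq x : ooint c%:E b x -> picone u v x != 0.
    by move=> /Gpos /gt_eqF ->.
  have : inv_sq_integral u c%:E b != +oo%E.
    apply: (@ooint_inv_sq_integral_fin _ _ _ _ (picone u v) G'
      (picone u v c)^-1) => //.
    + by move=> x /sub; exact: uc.
    + by move=> x /sub; exact: G'c.
    + by move=> x /sub; exact: dG.
    + by move=> x /sub; exact: GuG'.
    + move=> x y xI yI xy; rewrite -[leRHS]subr0 lerB//.
        by rewrite lef_pV2 ?posrE ?(Gpos _ xI)// Gge.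
      by rewrite invr_ge0 ltW// Gpos.
    + by rewrite invr_ge0 ltW.
  by rewrite u_right// eqxx.
Qed.

Theorem mainTheorem1 (R : realType) (a b : \bar R) (hab : (a < b)%E)
  (p P : R -> R)
  (p_cont : {within ooint a b, continuous p})
  (P_cont : {within ooint a b, continuous P})
  (u : R -> R)
  (u_sol : is_solution a b p u)
  (u_nontrivial : exists x : R, ooint a b x /\ u x <> 0)
  (u_left : diverges_at_left a b u)
  (u_right : diverges_at_right a b u)
  (p_le_P : forall x : R, ooint a b x -> p x <= P x)
  (P_neq_p : exists x : R, ooint a b x /\ P x <> p x) :
  forall v : R -> R, is_solution a b P v ->
    exists x : R, ooint a b x /\ v x = 0.
Proof.
move=> v v_sol; apply: contrapT => v_nozero.
have v0 x : ooint a b x -> v x != 0.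
  by move=> xI; apply/eqP => vx; apply: v_nozero; exists x.
have G0 := picone_eq0 p_cont P_cont u_sol v_sol u_left u_right p_le_P v0.
have G'0 x : ooint a b x ->
    (P x - p x) * u x ^+ 2 + (wronskian u v x / v x) ^+ 2 = 0.
  move=> xI; have dG := is_derive_picone u_sol v_sol (v0 _ xI) xI.
  have G_cst : \near x, picone u v x = cst 0 x.
    by apply: filterS (open_nbhs_nbhs (conj (@open_ooint R a b) xI)); exact: G0.
  have := near_eq_is_derive G_cst dG.
  by move=> /@derive_val; rewrite derive_cst.
have split0 x : ooint a b x ->
    (P x - p x) * u x ^+ 2 = 0 /\ wronskian u v x = 0.
  move=> xI; move/eqP: (G'0 _ xI).
  rewrite paddr_eq0 ?sqr_ge0//; last first.
    by rewrite mulr_ge0 ?sqr_ge0// subr_ge0 p_le_P.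
  move=> /andP[/eqP -> ]; rewrite expf_eq0/= mulf_eq0 invr_eq0.
  by rewrite (negbTE (v0 _ xI)) orbF => /eqP.
have dq : forall z : R, ooint a b z ->
    is_derive z (1 : R) (fun y => u y / v y) (0 : R).
  move=> z zI; have := is_derive_quotient u_sol v_sol (v0 _ zI) zI.
  by rewrite (split0 _ zI).2 mul0r.
have q_cst x y : ooint a b x -> ooint a b y -> u x / v x = u y / v y.
  move=> xI yI; wlog xy : x y xI yI / x <= y.
    by move=> H; case: (leP x y) => [|/ltW] /H ->.
  have [z _] := @ooint_MVT R a b _ (fun=> 0) _ _ dq xI yI xy.
  by rewrite mul0r => /eqP; rewrite subr_eq0 => /eqP.
have [x0 [x0I /eqP Pp]] := P_neq_p.
have [x1 [x1I]] := u_nontrivial; apply.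
have /eqP := (split0 _ x0I).1.
rewrite mulf_eq0 subr_eq0 (negbTE Pp) expf_eq0/= => /eqP ux0.
have /eqP := q_cst _ _ x1I x0I.
by rewrite ux0 mul0r mulf_eq0 invr_eq0 (negbTE (v0 _ x1I)) orbF => /eqP.
Qed.
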